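(* Let $R$ be a right non-singular ring and consider a commutative $3\times 3$ diagram of right $R$-modules and right $R$-module morphisms with rows $$0\to A_1\xrightarrow{f_1}A_2\xrightarrow{f_2}A_3\to 0,\qquad 0\to B_1\xrightarrow{g_1}B_2\xrightarrow{g_2}B_3\to 0,\qquad 0\to C_1\xrightarrow{h_1}C_2\xrightarrow{h_2}C_3\to 0$$ (top, middle and bottom respectively) and columns $$0\to A_1\xrightarrow{u_1}B_1\xrightarrow{u_2}C_1\to 0,\qquad 0\to A_2\xrightarrow{v_1}B_2\xrightarrow{v_2}C_2\to 0,\qquad 0\to A_3\xrightarrow{p_1}B_3\xrightarrow{p_2}C_3\to 0,$$ where commutativity means $v_1f_1=g_1u_1$, $p_1f_2=g_2v_1$, $v_2g_1=h_1u_2$, $p_2g_2=h_2v_2$. Suppose that $A_2$ and $A_3$ are non-singular modules. If the three columns and the two bottom rows are (short) $e$-exact, then the top row is also (short) $e$-exact.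
   Context: Rings are associative with identity $1\neq 0$, not necessarily commutative; modules are unitary right modules. A submodule $N\le M$ is essential in $M$ if $N\cap X\neq 0$ for every nonzero submodule $X$ of $M$. A short $e$-exact sequence is a cochain complex $0\to A\xrightarrow{f}B\xrightarrow{g}C\to 0$ of right $R$-modules (so $gf=0$) such that $f$ is a monomorphism, $f(A)$ is an essential submodule of $\ker(g)$, and $g(B)$ is an essential submodule of $C$. For a right $R$-module $M$, the singular submodule is $Z(M)=\{x\in M \mid xI=0 \text{ for some essential right ideal } I \text{ of } R\}$; $M$ is non-singular if $Z(M)=0$. The ring $R$ is right non-singular if $Z(R_R)=0$. *)

(* Defs.v *)
From HB Require Import structures.
From mathcomp Require Import all_boot all_algebra.
From mathcomp Require Import boolp classical_sets.

Set Implicit Arguments.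
Unset Strict Implicit.
Unset Printing Implicit Defensive.

Import GRing.Theory.
Local Open Scope ring_scope.
Local Open Scope classical_set_scope.

(* A right R-module is a left module over the converse ring R^c: for r : R^c
   and x : M, r *: x is the right action x r. *)
Notation rmodType R := (lmodType R^c).

(* The module R_R: right multiplication of R on itself, so that its submodules
   are the right ideals of R. *)
Notation right_regular R := ((R^c)^o).

Section EExact.
Variable R : nzRingType.

Definition submodule (M : rmodType R) (N : set M) : Prop :=
  submod_closed [in N].

Definition essential_in (M : rmodType R) (N L : set M) : Prop :=
  [/\ submodule L, submodule N, N `<=` L &
      forall X : set M, submodule X -> X `<=` L ->
        X <> [set 0] -> N `&` X <> [set 0]].

Definition ker (M N : rmodType R) (f : {linear M -> N}) : set M :=
  f @^-1` [set 0].

Definition short_e_exact (A B C : rmodType R)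
    (f : {linear A -> B}) (g : {linear B -> C}) : Prop :=
  [/\ forall a, g (f a) = 0,
      injective f,
      essential_in (range f) (ker g) &
      essential_in (range g) [set: C]].

Definition essential_right_ideal (I : set (right_regular R)) : Prop :=
  essential_in I [set: right_regular R].

Definition singular_submodule (M : rmodType R) : set M :=
  [set x | exists2 I : set (right_regular R), essential_right_ideal I &
     forall r : R^c, I r -> r *: x = 0].

Arguments singular_submodule : clear implicits.

Definition nonsingular (M : rmodType R) : Prop :=
  singular_submodule M = [set 0].

End EExact.

Definition right_nonsingular (R : nzRingType) : Prop :=
  nonsingular (right_regular R).

(* Main.v *)
Require Import Defs.
From HB Require Import structures.
From mathcomp Require Import all_boot all_algebra.
From mathcomp Require Import boolp classical_sets.

(** Essentiality of [N] in [L] is tested on elements: each nonzero [x] in [L]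
    has a nonzero multiple in [N].  Exactness at [A_2] is then an ordinary
    diagram chase.  For the essentiality of the image of [f_2], chasing a given
    nonzero [y] in [A_3] requires replacing auxiliary elements by multiples lying
    in various essential submodules.  The multipliers that achieve this form an
    essential right ideal, so, as [A_3] is non-singular, they can be chosen
    without killing [y]. *)

Set Implicit Arguments.
Unset Strict Implicit.
Unset Printing Implicit Defensive.

Import GRing.Theory.
Local Open Scope ring_scope.

Local Open Scope classical_set_scope.

Section Essential.
Variable R : nzRingType.

Section Submodules.
Variable M : rmodType R.
Implicit Types (N L : set M) (x y : M).

Lemma submoduleP N :
  submodule N <->
  N 0 /\ forall (r : R^c) x y, N x -> N y -> N (r *: x + y).
Proof.
split=> [[N0 NL]|[N0 NL]].
  split; first by rewrite inE in N0.
  by move=> r x y Nx Ny; have := NL r x y; rewrite !inE; apply.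
split; first by rewrite inE.
by move=> r x y; rewrite !inE; apply: NL.
Qed.

Lemma submodule0 N : submodule N -> N 0.
Proof. by case/submoduleP. Qed.

Lemma submoduleZ N (r : R^c) x : submodule N -> N x -> N (r *: x).
Proof.
by case/submoduleP=> N0 NL Nx; rewrite -[_ *: _]addr0; apply: NL.
Qed.

Lemma submodule_setT : submodule [set: M].
Proof. exact/submoduleP. Qed.

Lemma submodule_cyclic x : submodule (range (fun r : R^c => r *: x)).
Proof.
apply/submoduleP; split; first by exists 0; rewrite ?scale0r.
move=> r _ _ [s _ <-] [t _ <-]; exists (r * s + t) => //.
by rewrite scalerDl scalerA.
Qed.

(** Essentiality is applied to the cyclic submodule generated by [x]: if no nonzero multiple of [x]
    were in [N], this submodule would meet [N] trivially. *)
Lemma essential_in_multiple N L x :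
  essential_in N L -> L x -> x <> 0 ->
  exists2 r : R^c, N (r *: x) & r *: x <> 0.
Proof.
move=> [subL subN _ essN] Lx x0; apply: contrapT => noN.
apply: (essN _ (submodule_cyclic x)).
- by move=> _ [r _ <-]; apply: submoduleZ.
- move=> cyc0; apply: x0.
  suff : range (fun r : R^c => r *: x) x by rewrite cyc0.
  by exists 1; rewrite ?scale1r.
- apply/seteqP; split=> [y [Ny [r _ rxy]]|_ ->].
    by rewrite -rxy in Ny *; apply: contrapT => rx0; apply: noN; exists r.
  by split; apply: submodule0 => //; apply: submodule_cyclic.
Qed.

Lemma essential_in_of_multiple N L :
  submodule L -> submodule N -> N `<=` L ->
  (forall x, L x -> x <> 0 -> exists2 r : R^c, N (r *: x) & r *: x <> 0) ->
  essential_in N L.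
Proof.
move=> subL subN NL mulN; split=> // X subX XL X0 NX0.
apply: X0; apply/seteqP; split=> [x Xx|_ ->]; last exact: submodule0.
apply: contrapT => x0; have [r Nrx rx0] := mulN x (XL x Xx) x0.
apply: rx0; suff : (N `&` X) (r *: x) by rewrite NX0.
by split=> //; apply: submoduleZ.
Qed.

End Submodules.

(** Given [s <> 0], either [s *: x = 0] and [s] already lies in the colon ideal, or some [r] moves
    [s *: x] to a nonzero element of [N], which forces [r * s <> 0]. *)
Lemma essential_colon (M : rmodType R) (N L : set M) (x : M) :
  essential_in N L -> L x ->
  essential_right_ideal [set r : right_regular R | N ((r : R^c) *: x)].
Proof.
move=> essN Lx; have [subL /submoduleP[N0 NL] _ _] := essN.
apply: essential_in_of_multiple => //.
- exact/submoduleP.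
- apply/submoduleP; split=> [|r s t /= Ns Nt]; first by rewrite /= scale0r.
  by rewrite scalerDl -scalerA; apply: NL.
- move=> s _ s0; have [sx0|/eqP sx0] := eqVneq ((s : R^c) *: x) 0.
    by exists 1; rewrite /= scale1r // sx0.
  have [r Nr r0] := essential_in_multiple essN (submoduleZ s subL Lx) sx0.
  exists r; first by rewrite /= -scalerA.
  (* The action on [right_regular R] is the product of [R^c], so [rs0] is convertible to
     [r * s = 0]. *)
  by move=> rs0; apply: r0; rewrite scalerA [_ * _]rs0 scale0r.
Qed.

Lemma nonsingular_essential_multiple (M : rmodType R)
    (I : set (right_regular R)) (x : M) :
  nonsingular M -> essential_right_ideal I -> x <> 0 ->
  exists2 r : R^c, I r & r *: x <> 0.
Proof.
move=> nsM essI x0; apply: contrapT => noI; apply: x0.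
suff : @singular_submodule R M x by rewrite nsM.
exists I => // r Ir; apply: contrapT => rx0.
by apply: noI; exists r.
Qed.

(** The multipliers taking [x] into [N] form an essential right ideal, which cannot annihilate the
    nonzero [y] of a non-singular module. No relation between [x] and [y] is needed, and [x] may be
    zero. *)
Lemma essential_multiple_nonsingular (M M' : rmodType R) (N L : set M)
    (x : M) (y : M') :
  nonsingular M' -> essential_in N L -> L x -> y <> 0 ->
  exists2 r : R^c, N (r *: x) & r *: y <> 0.
Proof.
move=> nsM' essN Lx.
exact: nonsingular_essential_multiple nsM' (essential_colon essN Lx).
Qed.

Lemma submodule_range (M N : rmodType R) (f : {linear M -> N}) :
  submodule (range f).
Proof.
apply/submoduleP; split; first by exists 0; rewrite ?linear0.
by move=> r _ _ [x _ <-] [y _ <-]; exists (r *: x + y); rewrite ?linearP.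
Qed.

Lemma submodule_ker (M N : rmodType R) (f : {linear M -> N}) :
  submodule (ker f).
Proof.
apply/submoduleP; rewrite /ker /=; split; first exact: linear0.
by move=> r x y fx fy; rewrite linearP fx fy scaler0 addr0.
Qed.

Lemma linear_inj_neq0 (M N : rmodType R) (f : {linear M -> N}) (x : M) :
  injective f -> x <> 0 -> f x <> 0.
Proof. by move=> injf x0 fx0; apply/x0/injf; rewrite fx0 linear0. Qed.

End Essential.

Local Close Scope classical_set_scope.

Theorem proposition3p3 (R : nzRingType)
  (A1 A2 A3 B1 B2 B3 C1 C2 C3 : rmodType R)
  (f1 : {linear A1 -> A2}) (f2 : {linear A2 -> A3})
  (g1 : {linear B1 -> B2}) (g2 : {linear B2 -> B3})
  (h1 : {linear C1 -> C2}) (h2 : {linear C2 -> C3})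
  (u1 : {linear A1 -> B1}) (u2 : {linear B1 -> C1})
  (v1 : {linear A2 -> B2}) (v2 : {linear B2 -> C2})
  (p1 : {linear A3 -> B3}) (p2 : {linear B3 -> C3})
  (R_nonsing : right_nonsingular R)
  (comm_v1f1 : v1 \o f1 =1 g1 \o u1)
  (comm_p1f2 : p1 \o f2 =1 g2 \o v1)
  (comm_v2g1 : v2 \o g1 =1 h1 \o u2)
  (comm_p2g2 : p2 \o g2 =1 h2 \o v2)
  (A2_nonsing : nonsingular A2) (A3_nonsing : nonsingular A3)
  (col1 : short_e_exact u1 u2)
  (col2 : short_e_exact v1 v2)
  (col3 : short_e_exact p1 p2)
  (row2 : short_e_exact g1 g2)
  (row3 : short_e_exact h1 h2) :
  short_e_exact f1 f2.
Proof.
have [_ inju essu1 essu2] := col1.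
have [v2v1 injv essv1 _] := col2.
have [p2p1 injp _ _] := col3.
have [g2g1 injg essg1 essg2] := row2.
have [_ injh essh1 _] := row3.
have f2f1 a : f2 (f1 a) = 0.
  apply: injp; rewrite linear0 [LHS]comm_p1f2 /=.
  by rewrite [v1 _]comm_v1f1 /= g2g1.
have injf1 : injective f1.
  move=> a a' faa'; apply/inju/injg.
  by rewrite -[LHS]comm_v1f1 -[RHS]comm_v1f1 /= faa'.
split=> //; apply: essential_in_of_multiple.
- exact: submodule_ker.
- exact: submodule_range.
- by move=> _ [a _ <-]; apply: f2f1.
- move=> x f2x x0.
  have g2v1x : ker g2 (v1 x).
    by rewrite /ker /= -[LHS]comm_p1f2 /= f2x linear0.
  have [r [b _ g1b] rx0] :=
    essential_in_multiple essg1 g2v1x (linear_inj_neq0 injv x0).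
  (* Since [g1 b] is the image under [v1] of [r *: x], it is killed by [v2]; commutativity and
     injectivity of [h1] then give [u2 b = 0]. *)
  have u2b : ker u2 b.
    apply: injh; rewrite linear0 -[LHS]comm_v2g1 /= g1b.
    by rewrite -linearZ v2v1.
  have b0 : b <> 0 by move=> b0; apply: rx0; rewrite -g1b b0 linear0.
  have [s [a _ u1a] sb0] := essential_in_multiple essu1 u2b b0.
  have f1a : f1 a = (s * r) *: x.
    apply: injv; rewrite [LHS]comm_v1f1 /= u1a linearZ /= g1b.
    by rewrite scalerA linearZ.
  exists (s * r); first by exists a.
  rewrite -f1a; apply: linear_inj_neq0 => // a0.
  by apply: sb0; rewrite -u1a a0 linear0.
- exact: submodule_setT.
- exact: submodule_range.
- by [].
- move=> y _ y0.
  (* Each of the four multipliers [r], [s], [t], [w] is chosen to keep the current multiple of [y]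
     nonzero, since auxiliary elements such as [v2 b] and [c] may vanish. *)
  have [r [b _ g2b] ry0] :=
    essential_multiple_nonsingular (x := p1 y) A3_nonsing essg2 I y0.
  have h2v2b : ker h2 (v2 b).
    by rewrite /ker /= -[LHS]comm_p2g2 /= g2b linearZ /= p2p1 scaler0.
  have [s [c _ h1c] sry0] :=
    essential_multiple_nonsingular A3_nonsing essh1 h2v2b ry0.
  have [t [d _ u2d] tsry0] :=
    essential_multiple_nonsingular (x := c) A3_nonsing essu2 I sry0.
  (* Subtracting [g1 d] cancels the image in [C2], and leaves the image in [B3] unchanged because
     [g2] kills [g1 d]. *)
  have v2e : ker v2 (t *: (s *: b) - g1 d).
    rewrite /ker /= linearB [v2 (g1 d)]comm_v2g1 /= u2d !linearZ /= h1c.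
    by rewrite -scalerDr subrr scaler0.
  have [w [a _ v1a] wtsry0] :=
    essential_multiple_nonsingular A3_nonsing essv1 v2e tsry0.
  exists (w * (t * (s * r))); last by rewrite -!scalerA.
  (* The equality is checked in [B3], where [p1 (f2 a) = g2 (v1 a)] reduces to a multiple of
     [g2 b = r *: p1 y]. *)
  exists a => //; apply: injp.
  rewrite [LHS]comm_p1f2 /= v1a linearZ linearB /= g2g1 subr0 !linearZ /= g2b.
  by rewrite -!scalerA.
Qed.
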